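(* Each of the following four generalized flag manifolds $G/K$ admits a non-trivial structural equigeodesic vector: $\mathrm{F}_4/(\mathrm{U}(3)\times \mathrm{U}(1))$, $\mathrm{E}_6/(\mathrm{U}(3)\times \mathrm{U}(3))$, $\mathrm{E}_7/(\mathrm{U}(6)\times \mathrm{U}(1))$ and $\mathrm{E}_8/(\mathrm{E}_6\times \mathrm{U}(1)\times \mathrm{U}(1))$, where these denote the flag manifolds determined by painting black, respectively, the simple roots $\{\alpha_3,\alpha_4\}$ of $\mathrm{F}_4$, $\{\alpha_3,\alpha_6\}$ of $\mathrm{E}_6$, $\{\alpha_5,\alpha_6\}$ of $\mathrm{E}_7$ and $\{\alpha_1,\alpha_2\}$ of $\mathrm{E}_8$ (in the numbering given in the context).
   Context: **Lie-theoretic setting.** $G$ is a compact simply connected simple Lie group with Lie algebra $\mathfrak g$, $\mathfrak h$ is the Lie algebra of a maximal torus, $R$ is the root system of $\mathfrak g^{\mathbb C}$ relative to $\mathfrak h^{\mathbb C}$, $\Pi$ is a basis of simple roots, $R^+$ the positive roots, and $B$ the Killing form. For a root $\alpha$, $H_\alpha\in\mathfrak h^{\mathbb C}$ is defined by $B(H,H_\alpha)=\alpha(H)$ for all $H\in\mathfrak h^{\mathbb C}$. Choose root vectors $E_\alpha$ with $B(E_\alpha,E_{-\alpha})=-1$, $[E_\alpha,E_{-\alpha}]=-H_\alpha$, and $[E_\alpha,E_\beta]=N_{\alpha,\beta}E_{\alpha+\beta}$ if $\alpha+\beta\in R$ (with $N_{\alpha,\beta}\in\mathbb R\setminus\{0\}$,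 $N_{\alpha,\beta}=N_{-\alpha,-\beta}$), $[E_\alpha,E_\beta]=0$ if $\alpha+\beta\notin R\cup\{0\}$, such that conjugation of $\mathfrak g^{\mathbb C}$ with respect to $\mathfrak g$ sends $E_\alpha$ to $E_{-\alpha}$. Put $A_\alpha=E_\alpha+E_{-\alpha}$, $B_\alpha=\sqrt{-1}(E_\alpha-E_{-\alpha})$, $\mathfrak U_\alpha=\mathbb RA_\alpha+\mathbb RB_\alpha$ for $\alpha\in R^+$; then $\mathfrak g=\mathfrak h\oplus\bigoplus_{\alpha\in R^+}\mathfrak U_\alpha$. **Flag manifolds.** Given a subset $\Pi_M=\{\alpha_i,\alpha_j\}\subset\Pi$ (the simple roots ''painted black''), let $\Pi_K=\Pi\setminus\Pi_M$, let $R_K$ be the set of roots that are integer combinations of $\Pi_K$, let $R_K^+=R_K\cap R^+$, $R_M^+=R^+\setminus R_K^+$, and let $K\subset G$ be the connected subgroup with Lie algebra $\mathfrak k=\mathfrak h\oplus\bigoplus_{\alpha\in R_K^+}\mathfrak U_\alpha$. Then $G/K$ is a generalized flag manifold with tangent space $T_{o}(G/K)\cong\mathfrak m=\bigoplus_{\alpha\in R_M^+}\mathfrak U_\alpha$. For integers $(a,b)\ne(0,0)$ let $R^{\mathfrak m}(a,b)$ be the set of positive roots whose coefficients at $\alpha_i,\alpha_j$ are $a,b$, and $\mathfrak m(a,b)=\bigoplus_{\alpha\in R^{\mathfrak m}(a,b)}\mathfrak U_\alpha$. In all cases considered here exactly six of these are non-zero, they are irreducible and pairwise inequivalent as $\mathrm{Ad}(K)$-modules,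 and $\mathfrak m$ is their direct sum; call them $\mathfrak m_1,\dots,\mathfrak m_6$. **Numbering of simple roots.** $\mathrm F_4$: chain $\alpha_1-\alpha_2\Leftarrow\alpha_3-\alpha_4$ with $\alpha_1,\alpha_2$ short and $\alpha_3,\alpha_4$ long. $\mathrm E_6$: chain $\alpha_1-\cdots-\alpha_5$, with $\alpha_6$ attached to $\alpha_3$. $\mathrm E_7$: chain $\alpha_1-\cdots-\alpha_6$, with $\alpha_7$ attached to $\alpha_4$. $\mathrm E_8$: chain $\alpha_1-\cdots-\alpha_7$, with $\alpha_8$ attached to $\alpha_5$. **Equigeodesic vectors.** $G$-invariant metrics on $G/K$ correspond to operators $\Lambda:\mathfrak m\to\mathfrak m$ with $\Lambda|_{\mathfrak m_i}=\lambda_i\,\mathrm{Id}$, $\lambda_1,\dots,\lambda_6>0$ arbitrary (via $\langle\cdot,\cdot\rangle=-B(\Lambda\cdot,\cdot)$). A non-zero $X\in\mathfrak m$ is an equigeodesic vector if $t\mapsto(\exp tX)\cdot o$ is a geodesic for every $G$-invariant metric; equivalently $[X,\Lambda X]_{\mathfrak m}=0$ for every such $\Lambda$ (subscript: projection to $\mathfrak m$ along $\mathfrak k$). Writing $X=\sum_{\alpha\in S}(x_\alpha A_\alpha+y_\alpha B_\alpha)$, where $S\subset R_M^+$ is the set of roots for which $(x_\alpha,y_\alpha)\neq(0,0)$, this condition is an algebraic system in the variables $x_\alpha,y_\alpha$ ($\alpha\in S$). The vector $X$ is called *structural* if this system vanishes identically, i.e. $[Y,\Lambda Y]_{\mathfrak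 m}=0$ for all $Y\in\bigoplus_{\alpha\in S}\mathfrak U_\alpha$ and all $\Lambda$. An equigeodesic vector is *trivial* if it lies in a single $\mathfrak m_i$, and *non-trivial* otherwise. *)

(* Defs.v *)
From HB Require Import structures.
From mathcomp Require Import all_boot all_order all_algebra.
From mathcomp Require Import boolp reals.
From mathcomp Require Import complex.
Set Implicit Arguments.
Unset Strict Implicit.
Unset Printing Implicit Defensive.
Import Order.TTheory GRing.Theory Num.Theory.
Local Open Scope ring_scope.

(** * Finite-dimensional Lie algebras *)

HB.mixin Record Vector_isLieAlgebra (F : fieldType) (L : Type)
    of Vector F L := {
  lie : L -> L -> L;
  lie_linear_l : forall y : L, linear (lie^~ y);
  lie_linear_r : forall x : L, linear (lie x);
  liexx : forall x : L, lie x x = 0;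
  lie_jacobi : forall x y z : L,
    lie x (lie y z) + lie y (lie z x) + lie z (lie x y) = 0
}.

#[short(type="lieAlgType")]
HB.structure Definition LieAlgebra (F : fieldType) :=
  { L of Vector_isLieAlgebra F L & Vector F L }.

Notation "[[ x , y ]]" := (lie x y)
  (at level 0, x, y at level 99, format "[[ x ,  y ]]") : ring_scope.

(* tr (ad x \o ad y), computed in the basis [vbasis fullv]. *)
Definition killing (F : fieldType) (L : lieAlgType F) (x y : L) : F :=
  \sum_(i < \dim (fullv : {vspace L}))
    coord (vbasis fullv) i [[x, [[y, (vbasis fullv)`_i]]]].

Definition lie_abelian (F : fieldType) (L : lieAlgType F) (U : {vspace L}) :=
  forall x y, x \in U -> y \in U -> [[x, y]] = 0.

Definition lie_ideal (F : fieldType) (L : lieAlgType F) (I : {vspace L}) :=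
  forall x y, y \in I -> [[x, y]] \in I.

Definition lie_simple (F : fieldType) (L : lieAlgType F) :=
  ~ lie_abelian (fullv : {vspace L}) /\
  forall I : {vspace L}, lie_ideal I -> I = 0%VS \/ I = fullv.

(* A real simple Lie algebra is the Lie algebra of a compact (simply
   connected) Lie group iff its Killing form is negative definite. *)
Definition compact_simple (R : realType) (g : lieAlgType R) :=
  lie_simple g /\ forall x : g, x != 0 -> killing x x < 0.

Definition maximal_abelian (F : fieldType) (L : lieAlgType F)
    (h : {vspace L}) :=
  lie_abelian h /\
  forall U : {vspace L}, lie_abelian U -> (h <= U)%VS -> U = h.

(** * Complexification; [Cplx x y] stands for [x + i y] *)

Record cplx (V : Type) : Type := Cplx { re_part : V; im_part : V }.

Definition cplx_pair (V : Type) (u : cplx V) : V * V := (re_part u, im_part u).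
Definition pair_cplx (V : Type) (p : V * V) : cplx V := Cplx p.1 p.2.
Fact cplx_pairK (V : Type) : cancel (@cplx_pair V) (@pair_cplx V).
Proof. by case. Qed.

HB.instance Definition _ (V : choiceType) := Choice.copy (cplx V)
  (can_type (@cplx_pairK V)).

Section CplxZmodule.
Variable V : zmodType.
Implicit Types u v w : cplx V.

Definition cplx_zero : cplx V := Cplx 0 0.
Definition cplx_opp u := Cplx (- re_part u) (- im_part u).
Definition cplx_add u v :=
  Cplx (re_part u + re_part v) (im_part u + im_part v).

Fact cplx_addA : associative cplx_add.
Proof. by case=> [a b] [c d] [e f]; rewrite /cplx_add /= !addrA. Qed.
Fact cplx_addC : commutative cplx_add.
Proof. by case=> [a b] [c d]; congr Cplx; rewrite addrC. Qed.
Fact cplx_add0 : left_id cplx_zero cplx_add.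
Proof. by case=> [a b]; rewrite /cplx_add /= !add0r. Qed.
Fact cplx_addN : left_inverse cplx_zero cplx_opp cplx_add.
Proof. by case=> [a b]; rewrite /cplx_add /= !addNr. Qed.

HB.instance Definition _ := GRing.isZmodule.Build (cplx V)
  cplx_addA cplx_addC cplx_add0 cplx_addN.
End CplxZmodule.

Section CplxVector.
Variables (R : realType) (V : vectType R).
Implicit Types (u v w : cplx V) (c : R[i]).

Definition cplx_scale c u : cplx V :=
  Cplx (complex.Re c *: re_part u - complex.Im c *: im_part u)
       (complex.Re c *: im_part u + complex.Im c *: re_part u).

Fact cplx_scaleA a b u :
  cplx_scale a (cplx_scale b u) = cplx_scale (a * b) u.
Proof.
case: a b u => [a a'] [b b'] [x y]; rewrite /cplx_scale /=.
rewrite !scalerDr !scalerN !scalerDl !scaleNr !scalerA.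
congr Cplx; rewrite -!addrA; congr (_ + _).
- by rewrite !opprD [RHS]addrC -addrA.
- by rewrite [RHS]addrC -addrA.
Qed.

Fact cplx_scale1 : left_id 1 cplx_scale.
Proof.
by case=> [x y]; rewrite /cplx_scale /= !scale1r !scale0r subr0 addr0.
Qed.

Fact cplx_scaleDr : right_distributive cplx_scale +%R.
Proof.
move=> a [x y] [x' y']; congr Cplx; rewrite /= !scalerDr ?opprD;
  by rewrite addrACA.
Qed.

Fact cplx_scaleDl u : {morph cplx_scale^~ u : a b / a + b}.
Proof.
case: u => [x y] [a a'] [b b']; congr Cplx; rewrite /= !scalerDl ?opprD;
  by rewrite addrACA.
Qed.

HB.instance Definition _ := GRing.Zmodule_isLmodule.Build R[i] (cplx V)
  cplx_scaleA cplx_scale1 cplx_scaleDr cplx_scaleDl.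

Fact cplx_vect_iso : Vector.axiom (\dim (fullv : {vspace V})) (cplx V).
Proof.
pose n := \dim (fullv : {vspace V}).
pose e : n.-tuple V := vbasis fullv.
pose f u : 'rV[R[i]]_n :=
  \row_(i < n) (coord e i (re_part u) +i* coord e i (im_part u))%C.
pose g (r : 'rV[R[i]]_n) : cplx V :=
  Cplx (\sum_i complex.Re (r 0 i) *: e`_i) (\sum_i complex.Im (r 0 i) *: e`_i).
have eb : basis_of fullv e by exact: vbasisP.
exists f.
- move=> c u v; apply/rowP=> i; rewrite !mxE.
  case: c u v => [c c'] [x y] [x' y'] /=.
  by rewrite !linearD !linearN !linearZ.
- exists g; [move=> [x y] | move=> r].
  + by congr Cplx; rewrite [RHS](coord_basis eb (memvf _));
      apply: eq_bigr => i _; rewrite mxE.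
  + apply/rowP => i; rewrite mxE /= !coord_sum_free ?(basis_free eb) //.
    by case: (r 0 i).
Qed.

HB.instance Definition _ :=
  Lmodule_hasFinDim.Build R[i] (cplx V) cplx_vect_iso.

Definition cplx_of (x : V) : cplx V := Cplx x 0.
Definition cplx_conj u : cplx V := Cplx (re_part u) (- im_part u).

Definition cplx_vspace (U : {vspace V}) : {vspace (cplx V)} :=
  <<[seq cplx_of x | x <- vbasis U]>>%VS.

End CplxVector.

Section CplxLie.
Variables (R : realType) (g : lieAlgType R).
Implicit Types u v w : cplx g.

Definition cplx_lie u v : cplx g :=
  Cplx ([[re_part u, re_part v]] - [[im_part u, im_part v]])
       ([[re_part u, im_part v]] + [[im_part u, re_part v]]).

Fact lieDl (x y z : g) : [[x + y, z]] = [[x, z]] + [[y, z]].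
Proof. by have := lie_linear_l z 1 x y; rewrite !scale1r. Qed.
Fact lieDr (x y z : g) : [[z, x + y]] = [[z, x]] + [[z, y]].
Proof. by have := lie_linear_r z 1 x y; rewrite !scale1r. Qed.
Fact lie0l (x : g) : [[0, x]] = 0.
Proof. by apply: (addrI [[0, x]]); rewrite -lieDl !addr0. Qed.
Fact lie0r (x : g) : [[x, 0]] = 0.
Proof. by apply: (addrI [[x, 0]]); rewrite -lieDr !addr0. Qed.
Fact lieZl (a : R) (x y : g) : [[a *: x, y]] = a *: [[x, y]].
Proof. by have := lie_linear_l y a x 0; rewrite !addr0 lie0l addr0. Qed.
Fact lieZr (a : R) (x y : g) : [[y, a *: x]] = a *: [[y, x]].
Proof. by have := lie_linear_r y a x 0; rewrite !addr0 lie0r addr0. Qed.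
Fact lieNl (x y : g) : [[- x, y]] = - [[x, y]].
Proof. by rewrite -scaleN1r lieZl scaleN1r. Qed.
Fact lieNr (x y : g) : [[y, - x]] = - [[y, x]].
Proof. by rewrite -scaleN1r lieZr scaleN1r. Qed.
Fact lieC (x y : g) : [[x, y]] = - [[y, x]].
Proof.
apply/eqP; rewrite -addr_eq0; apply/eqP.
by have := liexx (x + y); rewrite lieDl !lieDr !liexx add0r addr0.
Qed.

Fact cplx_liexx u : cplx_lie u u = 0.
Proof.
case: u => [x y]; congr Cplx; rewrite /= ?liexx ?subrr //.
by rewrite lieC addNr.
Qed.

Fact cplx_lieC u v : cplx_lie u v = - cplx_lie v u.
Proof.
case: u v => [x y] [x' y']; congr Cplx; rewrite /= ?opprB ?opprD.
- by rewrite (lieC x) (lieC y) opprK addrC.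
- by rewrite (lieC x) (lieC y) addrC.
Qed.

Fact cplx_lie_linear_r u : linear (cplx_lie u).
Proof.
case: u => [x y] [a b] [x1 y1] [x2 y2]; congr Cplx.
- rewrite /= !(lieDr, lieNr, lieZr) !scalerDr !scalerN !opprD ?opprK.
  rewrite addrACA; congr (_ + _); rewrite -!addrA; congr (_ + _).
  exact: addrCA.
- rewrite /= !(lieDr, lieNr, lieZr) !scalerDr !scalerN.
  rewrite addrACA; congr (_ + _); rewrite -!addrA; congr (_ + _).
  exact: addrCA.
Qed.

Fact cplx_lie_linear_l v : linear (cplx_lie^~ v).
Proof.
move=> c u w; rewrite cplx_lieC cplx_lie_linear_r opprD -scalerN.
by rewrite -!cplx_lieC.
Qed.

Fact cplx_lie_jacobi u v w :
  cplx_lie u (cplx_lie v w) + cplx_lie v (cplx_lie w u)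
  + cplx_lie w (cplx_lie u v) = 0.
Proof.
case: u v w => [x y] [x' y'] [x'' y'']; congr Cplx => /=;
  rewrite !(lieDr, lieNr) ?opprD ?opprK.
- rewrite [LHS](AC ((2*2)*(2*2)*(2*2)) ((1*5*9)*(2*8*11)*(3*6*12)*(4*7*10)))%AC /=.
  by rewrite -!opprD !lie_jacobi oppr0 !addr0.
- rewrite [LHS](AC ((2*2)*(2*2)*(2*2)) ((1*6*11)*(2*7*9)*(3*5*10)*(4*8*12)))%AC /=.
  by rewrite -!opprD !lie_jacobi oppr0 !addr0.
Qed.

HB.instance Definition _ := Vector_isLieAlgebra.Build R[i] (cplx g)
  cplx_lie_linear_l cplx_lie_linear_r cplx_liexx cplx_lie_jacobi.

End CplxLie.

(** * Root systems and Weyl bases *)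

Notation dual h := ('Hom(subvs_of (cplx_vspace h), (_[i])^o)).

Definition is_root (R : realType) (g : lieAlgType R) (h : {vspace g})
    (a : dual h) :=
  a != 0 /\
  exists2 X : cplx g, X != 0 &
    forall H : subvs_of (cplx_vspace h), [[vsval H, X]] = (a H : R[i]) *: X.

(* The Lie algebra [torus] of a maximal torus, the roots, a basis of simple
   roots, the vectors H_a dual to the roots for the Killing form, and root
   vectors E_a normalised by B(E_a, E_-a) = -1 and compatible with the
   conjugation of the complexification with respect to g. *)
Record root_setup (R : realType) (g : lieAlgType R) (n : nat) := RootSetup {
  torus : {vspace g};
  torusP : maximal_abelian torus;

  roots : seq (dual torus);
  roots_uniq : uniq roots;
  rootsP : forall a, a \in roots <-> is_root a;

  simple : n.-tuple (dual torus);
  simple_free : free simple;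
  simple_root : {subset simple <= roots};
  simple_sign : forall a, a \in roots ->
    exists c : 'I_n -> nat,
      a = \sum_(k < n) simple`_k *+ c k \/ a = - \sum_(k < n) simple`_k *+ c k;

  Hvec : dual torus -> subvs_of (cplx_vspace torus);
  HvecP : forall a, a \in roots ->
    forall H, killing (vsval H) (vsval (Hvec a)) = a H;

  Evec : dual torus -> cplx g;
  Ncst : dual torus -> dual torus -> R;
  Evec_root : forall a, a \in roots ->
    forall H : subvs_of (cplx_vspace torus),
      [[vsval H, Evec a]] = (a H : R[i]) *: Evec a;
  Evec_killing : forall a, a \in roots -> killing (Evec a) (Evec (- a)) = -1;
  Evec_opp : forall a, a \in roots ->
    [[Evec a, Evec (- a)]] = - vsval (Hvec a);
  Evec_add : forall a b, a \in roots -> b \in roots -> a + b \in roots ->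
    [[Evec a, Evec b]] = (Ncst a b)%:C%C *: Evec (a + b);
  Ncst_neq0 : forall a b, a \in roots -> b \in roots -> a + b \in roots ->
    Ncst a b != 0;
  Ncst_opp : forall a b, a \in roots -> b \in roots -> a + b \in roots ->
    Ncst (- a) (- b) = Ncst a b;
  Evec_nonroot : forall a b, a \in roots -> b \in roots ->
    a + b != 0 -> a + b \notin roots -> [[Evec a, Evec b]] = 0;
  Evec_conj : forall a, a \in roots -> cplx_conj (Evec a) = Evec (- a)
}.

Arguments Hvec {R g n} D a : rename.
Arguments Evec {R g n} D a : rename.
Arguments Ncst {R g n} D a b : rename.

(* The Cartan integer 2 (a_p, a_q) / (a_q, a_q) *)
Definition cartan_number (R : realType) (g : lieAlgType R) (n : nat)
    (D : root_setup g n) (p q : 'I_n) : R[i] :=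
  let H k := vsval (Hvec D (tnth (simple D) k)) in
  2 * killing (H p) (H q) / killing (H q) (H q).

(* The nodes of a Dynkin diagram are numbered from 1, so that the simple root
   alpha_k is the entry of index k - 1 of [simple]. *)
Definition has_cartan_matrix (R : realType) (g : lieAlgType R) (n : nat)
    (D : root_setup g n) (C : nat -> nat -> int) :=
  forall p q : 'I_n, cartan_number D p q = (C p.+1 q.+1)%:~R.

Definition node (n k : nat) : 'I_n.+1 := inord k.-1.

Definition simply_laced (edges : seq (nat * nat)) (p q : nat) : int :=
  if p == q then 2
  else if ((p, q) \in edges) || ((q, p) \in edges) then -1 else 0.

(* 1 - 2 <= 3 - 4 with 1, 2 short and 3, 4 long, so that
   2 (a_3, a_2) / (a_2, a_2) = -2. *)
Definition cartan_F4 (p q : nat) : int :=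
  if (p, q) == (3, 2)%N then -2
  else simply_laced [:: (1, 2); (2, 3); (3, 4)]%N p q.
Definition cartan_E6 :=
  simply_laced [:: (1, 2); (2, 3); (3, 4); (4, 5); (3, 6)]%N.
Definition cartan_E7 :=
  simply_laced [:: (1, 2); (2, 3); (3, 4); (4, 5); (5, 6); (4, 7)]%N.
Definition cartan_E8 :=
  simply_laced
    [:: (1, 2); (2, 3); (3, 4); (4, 5); (5, 6); (6, 7); (5, 8)]%N.

(** * Flag manifolds with two black nodes, and equigeodesic vectors *)

Section Flag.
Variables (R : realType) (g : lieAlgType R) (n : nat) (D : root_setup g n).
Variables i j : 'I_n.

Notation "'Pi_ k" := ((simple D)`_k) (at level 8, k at level 2).

(* With conj E_a = E_-a, both E_a + E_-a and i (E_a - E_-a) have zero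
   imaginary part, so taking real parts lands in g without loss. *)
Definition Avec (a : dual (torus D)) : g := re_part (Evec D a + Evec D (- a)).
Definition Bvec (a : dual (torus D)) : g :=
  re_part ((0 +i* 1)%C *: (Evec D a - Evec D (- a))).
Definition Uspace (a : dual (torus D)) : {vspace g} :=
  <<[:: Avec a; Bvec a]>>%VS.

Definition pos_roots : seq (dual (torus D)) :=
  [seq a <- roots D | `[< exists c : 'I_n -> nat, a = \sum_(k < n) 'Pi_k *+ c k >]].

Definition in_RK (a : dual (torus D)) : bool :=
  `[< exists c : 'I_n -> int,
        a = \sum_(k < n | (k != i) && (k != j)) 'Pi_k *~ c k >].
Definition RK_pos := [seq a <- pos_roots | in_RK a].
Definition RM_pos := [seq a <- pos_roots | ~~ in_RK a].

Definition kspace : {vspace g} := (torus D + \sum_(a <- RK_pos) Uspace a)%VS.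
Definition mspace : {vspace g} := (\sum_(a <- RM_pos) Uspace a)%VS.

Definition Rm (a b : int) : seq (dual (torus D)) :=
  [seq al <- pos_roots | (coord (simple D) i al == a%:~R)
                         && (coord (simple D) j al == b%:~R)].
Definition m_ (a b : int) : {vspace g} := (\sum_(al <- Rm a b) Uspace al)%VS.

(* The operators of the invariant metrics <X, Y> = - B(L X, Y); only the values
   of L on [mspace] matter. *)
Definition metric_operator (L : 'End(g)) :=
  exists lam : int -> int -> R,
    (forall a b, 0 < lam a b) /\
    forall a b, (a, b) != (0, 0) ->
      forall v, v \in m_ a b -> L v = lam a b *: v.

Definition mproj (v : g) : g := daddv_pi mspace kspace v.

(* [X, L X]_m = 0 for all L is the infinitesimal form of the requirement that
   t |-> (exp tX).o be a geodesic for every invariant metric on G/K. *)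
Definition equigeodesic (X : g) :=
  [/\ X \in mspace, X != 0 &
      forall L, metric_operator L -> mproj [[X, L X]] = 0].

Definition m_vector (x y : dual (torus D) -> R) : g :=
  \sum_(a <- RM_pos) (x a *: Avec a + y a *: Bvec a).
Definition m_support (x y : dual (torus D) -> R) : seq (dual (torus D)) :=
  [seq a <- RM_pos | (x a != 0) || (y a != 0)].

Definition structural (X : g) :=
  equigeodesic X /\
  exists x y : dual (torus D) -> R, X = m_vector x y /\
    forall Y, Y \in (\sum_(a <- m_support x y) Uspace a)%VS ->
      forall L, metric_operator L -> mproj [[Y, L Y]] = 0.

Definition trivial_vector (X : g) :=
  exists a b : int, (a, b) != (0, 0) /\ X \in m_ a b.

End Flag.

(* Main.v *)
Require Import Defs.
From HB Require Import structures.
From mathcomp Require Import all_boot all_order all_algebra.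
From mathcomp Require Import boolp reals.
From mathcomp Require Import complex.
Set Implicit Arguments.
Unset Strict Implicit.
Unset Printing Implicit Defensive.
Import Order.TTheory GRing.Theory Num.Theory.
Local Open Scope ring_scope.

(** Each of the four pairs of black nodes {b, c} is adjacent and lies at the end
    of a chain a - b - c of simple roots with a white.  The roots al = a + b and
    be = b + c are strongly orthogonal: al - be = a - c is not a root, and
    <al, be> = 0 then forces al + be not to be a root either.  Hence U_al and
    U_be commute, so [Y, L Y] = 0 for Y in U_al + U_be and every invariant
    metric L, while A_al + A_be has non-zero components in two different m_i. *)

(** * The Killing form *)

Section LieTheory.
Variables (F : fieldType) (L : lieAlgType F).
Implicit Types (x y z : L).

HB.instance Definition _ x := GRing.isLinear.Build F L L _ (lie x)
  (lie_linear_r x).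

Lemma lie_anti x y : [[x, y]] = - [[y, x]].
Proof.
apply/eqP; rewrite -addr_eq0; apply/eqP.
have lDl u v w : [[u + v, w]] = [[u, w]] + [[v, w]] :> L.
  by have := lie_linear_l w 1 u v; rewrite !scale1r.
by have := liexx (x + y); rewrite lDl !linearD /= !liexx add0r addr0.
Qed.

(** The bracket as a function of its left argument, named so that it can carry its own linear
    structure next to that of [lie x]. *)
Definition lier y x : L := [[x, y]].
HB.instance Definition _ y := GRing.isLinear.Build F L L _ (lier y)
  (lie_linear_l y).

(** The Jacobi identity in the form ad [x, y] = ad x ad y - ad y ad x. *)
Lemma lie_lie x y z : [[[[x, y]], z]] = [[x, [[y, z]]]] - [[y, [[x, z]]]].
Proof.
have := lie_jacobi x y z.
rewrite (lie_anti z x) (lie_anti z) linearN /= => /eqP.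
by rewrite subr_eq0 => /eqP.
Qed.

Lemma lie_span_eq0 (s t : seq L) :
    (forall x y, x \in s -> y \in t -> [[x, y]] = 0) ->
  forall x y, x \in <<s>>%VS -> y \in <<t>>%VS -> [[x, y]] = 0.
Proof.
move=> st0 x y xs yt; rewrite (coord_span (X := in_tuple t) yt) linear_sum.
rewrite big1 //= => i _.
rewrite linearZ /=; rewrite (coord_span (X := in_tuple s) xs).
rewrite -[lie _ _]/(lier _ _) linear_sum big1 ?scaler0 //= => k _.
by rewrite linearZ /= [lier _ _]st0 ?scaler0 ?mem_nth.
Qed.

Let e : (\dim (fullv : {vspace L})).-tuple L := vbasis fullv.

(** With f = ad x ad y this unfolds to [killing x y], so trace identities transfer to the Killing
    form by conversion. *)
Definition lin_trace (f : L -> L) : F := \sum_i coord e i (f e`_i).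

Lemma lin_traceC (f g : {linear L -> L}) :
  lin_trace (f \o g) = lin_trace (g \o f).
Proof.
have E (u v : {linear L -> L}) i : coord e i (u (v e`_i)) =
    \sum_k coord e k (v e`_i) * coord e i (u e`_k).
  rewrite {1}(coord_basis (vbasisP fullv) (memvf (v _))) !linear_sum /=.
  by apply: eq_bigr => k _; rewrite !linearZ.
rewrite /lin_trace /=; under eq_bigr do rewrite E.
rewrite exchange_big /=; apply: eq_bigr => k _; rewrite E.
by apply: eq_bigr => i _; rewrite mulrC.
Qed.

Lemma killingC x y : killing x y = killing y x.
Proof. exact: (lin_traceC (lie x) (lie y)). Qed.

Fact killing_linear x : linear (killing x : L -> F^o).
Proof.
move=> c y z; rewrite /killing scaler_sumr -big_split /=.
apply: eq_bigr => i _.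
by rewrite -[lie (_ + _) _]/(lier _ _) linearP /= linearP /= linearP.
Qed.
HB.instance Definition _ x := GRing.isLinear.Build F L F^o _
  (killing x : L -> F^o) (killing_linear x).

Lemma killingZr c x y : killing x (c *: y) = c * killing x y.
Proof. by rewrite [LHS]linearZ. Qed.

Lemma killingZl c x y : killing (c *: x) y = c * killing x y.
Proof. by rewrite killingC killingZr killingC. Qed.

Lemma killingDl x y z : killing (x + y) z = killing x z + killing y z.
Proof. by rewrite killingC [LHS]linearD /= !(killingC z). Qed.

Lemma killingNl x y : killing (- x) y = - killing x y.
Proof. by rewrite killingC [LHS]linearN /= killingC. Qed.

(** Expanding ad of a bracket as a commutator turns both sides into differences of traces of triple
    products. The first traces coincide, and the second ones agree by cyclicity. *)
Lemma killing_invariant x y z : killing [[x, y]] z = killing x [[y, z]].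
Proof.
have trB (f g : L -> L) : lin_trace (fun v => f v - g v)
    = lin_trace f - lin_trace g.
  by rewrite -sumrB; apply: eq_bigr => i _; rewrite linearB.
have -> : killing [[x, y]] z = lin_trace (lie x \o (lie y \o lie z))
    - lin_trace (lie y \o (lie x \o lie z)).
  by rewrite -trB; apply: eq_bigr => i _; rewrite lie_lie.
have -> : killing x [[y, z]] = lin_trace (lie x \o (lie y \o lie z))
    - lin_trace ((lie x \o lie z) \o lie y).
  by rewrite -trB; apply: eq_bigr => i _; rewrite lie_lie linearB.
by rewrite (lin_traceC (lie y) (lie x \o lie z)).
Qed.

(** Invariance gives B([x, h], y) = B(x, [h, y]), that is, -c B(x, y) = d B(x, y). *)
Lemma killing_eigen h x y c d : [[h, x]] = c *: x -> [[h, y]] = d *: y ->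
  (c + d) * killing x y = 0.
Proof.
move=> hx hy; have := killing_invariant x h y.
rewrite lie_anti hx hy killingNl killingZl killingZr => /eqP.
by rewrite eq_sym -subr_eq0 opprK -mulrDl addrC => /eqP.
Qed.

Lemma lie_lie0 x y z : [[x, z]] = 0 -> [[x, [[y, z]]]] = [[[[x, y]], z]].
Proof. by move=> xz; rewrite lie_lie xz linear0 subr0. Qed.

End LieTheory.

(** * Roots and root vectors *)

(* [fingraph.roots] shadows the projection of [root_setup]. *)
Local Notation roots := Defs.roots.

Section Roots.
Variables (R : realType) (g : lieAlgType R) (n : nat) (D : root_setup g n).
Implicit Types (a b : dual (torus D)) (x y : g) (u v : cplx g).
Implicit Types H : subvs_of (cplx_vspace (torus D)).

Lemma cplx_of_lie x y : cplx_of [[x, y]] = [[cplx_of x, cplx_of y]].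
Proof. by congr Cplx => /=; rewrite !(lie0l, lie0r) ?subr0 ?addr0. Qed.

Lemma cplx_ofD x y : cplx_of (x + y) = cplx_of x + cplx_of y.
Proof. by congr Cplx; rewrite /= addr0. Qed.

Lemma cplx_ofZ (c : R) x : cplx_of (c *: x) = c%:C%C *: cplx_of x.
Proof. by congr Cplx; rewrite /= ?scaler0 ?scale0r ?subr0 ?addr0. Qed.

Lemma cplx_conj_lie u v :
  cplx_conj [[u, v]] = [[cplx_conj u, cplx_conj v]].
Proof.
by congr Cplx => /=; rewrite !(lieNl, lieNr) ?opprK // opprD.
Qed.

Lemma cplx_conjZ (c : R[i]) u : cplx_conj (c *: u) = c^*%C *: cplx_conj u.
Proof.
case: c u => [c c'] [x y]; congr Cplx => /=;
  by rewrite !(scaleNr, scalerN) ?opprK // opprD.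
Qed.

Lemma Evec_neq0 a : a \in roots D -> Evec D a != 0.
Proof.
move=> ra; apply/eqP => E0; have /eqP := Evec_killing ra.
by rewrite killingC E0 [killing _ _]linear0 eq_sym oppr_eq0 oner_eq0.
Qed.

(** Not an instance of [Evec_neq0]: that - a is a root is deduced from this fact in [rootN]. *)
Lemma Evec_opp_neq0 a : a \in roots D -> Evec D (- a) != 0.
Proof.
move=> ra; apply/eqP => E0; have /eqP := Evec_killing ra.
by rewrite E0 [killing _ _]linear0 eq_sym oppr_eq0 oner_eq0.
Qed.

(** The complexified torus is spanned by real vectors, so a property stable under complex
    combinations need only be checked on those. There conjugation acts trivially. *)
Lemma torus_ind (P : subvs_of (cplx_vspace (torus D)) -> Prop) :
    P 0 -> (forall c H H', P H -> P H' -> P (c *: H + H')) ->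
    (forall H x, vsval H = cplx_of x -> P H) ->
  forall H, P H.
Proof.
move=> P0 PD Pre H; set s := [seq cplx_of x | x <- vbasis (torus D)].
have sP k : (k < size s)%N -> s`_k \in cplx_vspace (torus D).
  by move=> ks; rewrite memv_span ?mem_nth.
have -> : H = \sum_(k < size s) coord (in_tuple s) k (vsval H) *:
    vsproj (cplx_vspace (torus D)) s`_k.
  apply: val_inj; rewrite /= linear_sum /=.
  rewrite {1}(coord_span (X := in_tuple s) (subvsP H)).
  by apply: eq_bigr => k _; rewrite vsprojK ?sP.
apply: (big_rec P) => // k H' _; apply: PD.
have := mem_nth 0 (ltn_ord k) => /mapP[x _ sk].
by apply: (Pre _ x); rewrite vsprojK ?sP.
Qed.

(* On a real torus element H, conjugation gives [H, E_-a] = conj(a H) E_-a, and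
   invariance of the Killing form forces conj(a H) = - a H. *)
Lemma rootN a : a \in roots D -> - a \in roots D.
Proof.
move=> ra; have [a0 _] := (rootsP a).1 ra; apply/rootsP.
split; first by rewrite oppr_eq0.
exists (Evec D (- a)); first exact: Evec_opp_neq0.
apply: torus_ind => [|c H H' PH PH'|H x Hx].
- by rewrite !linear0 scale0r -[LHS]/(lier _ _) linear0.
- rewrite linearP /= -[LHS]/(lier _ _) linearP /= /lier PH PH'.
  by rewrite linearP /= scalerDl scalerA.
have HE : [[vsval H, Evec D (- a)]] = (a H : R[i])^*%C *: Evec D (- a).
  have := congr1 (@cplx_conj _ _) (Evec_root ra H).
  rewrite cplx_conj_lie cplx_conjZ (Evec_conj ra) Hx.
  by congr ([[_, _]] = _); congr Cplx; rewrite oppr0.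
have /eqP := killing_eigen (Evec_root ra H) HE.
rewrite (Evec_killing ra) mulrN1 oppr_eq0 addrC addr_eq0 => /eqP aH.
by rewrite HE opp_lfunE aH.
Qed.

(** If the pairing were non-zero, [killing_eigen] would give a(H) + b(H) = 0 for every H in the
    torus. *)
Lemma killing_Evec_eq0 a b : a \in roots D -> b \in roots D -> a + b != 0 ->
  killing (Evec D a) (Evec D b) = 0.
Proof.
move=> ra rb /eqP ab; apply/eqP/negPn/negP => k0; apply: ab.
apply/lfunP => H; rewrite add_lfunE zero_lfunE.
have /eqP := killing_eigen (Evec_root ra H) (Evec_root rb H).
by rewrite mulf_eq0 (negPf k0) orbF => /eqP.
Qed.

(** As a - b is not a root, E_-b kills E_a, and Jacobi gives [E_-b, [E_b, E_a]] = [H_b, E_a] =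
    a(H_b) E_a. The left side is E_a times two non-zero structure constants if a + b is a root, and
    0 otherwise. *)
Lemma add_root a b : a \in roots D -> b \in roots D ->
    a - b != 0 -> a - b \notin roots D -> a + b != 0 ->
  (a + b \in roots D) = ((a (Hvec D b) : R[i]) != 0).
Proof.
move=> ra rb ab0 ab s0; have rNb := rootN rb.
have bb : [[Evec D (- b), [[Evec D b, Evec D a]]]]
    = (a (Hvec D b) : R[i]) *: Evec D a.
  rewrite lie_lie0; last by rewrite Evec_nonroot // addrC.
  by rewrite (lie_anti (Evec D (- b))) Evec_opp // opprK Evec_root.
apply/idP/idP => [rs|].
  have rs' : b + a \in roots D by rewrite addrC.
  have rN : - b + (b + a) \in roots D by rewrite addKr.
  have := bb; rewrite (Evec_add rb ra rs') linearZ /= (Evec_add rNb rs' rN).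
  rewrite addKr scalerA => E; apply/eqP => z.
  move: E; rewrite z scale0r => /eqP; rewrite scaler_eq0 (negPf (Evec_neq0 ra)).
  rewrite orbF mulf_eq0 !fmorph_eq0.
  by rewrite (negPf (Ncst_neq0 rb ra rs')) (negPf (Ncst_neq0 rNb rs' rN)).
apply: contraR => rs; have := bb.
rewrite (Evec_nonroot rb ra) 1?addrC // linear0.
by move/esym/eqP; rewrite scaler_eq0 (negPf (Evec_neq0 ra)) orbF.
Qed.

Lemma cplx_of_Avec a : a \in roots D ->
  cplx_of (Avec a) = Evec D a + Evec D (- a).
Proof.
by move=> ra; rewrite /Avec -(Evec_conj ra); congr Cplx; rewrite /= subrr.
Qed.

Lemma cplx_of_Bvec a : a \in roots D ->
  cplx_of (Bvec a) = (0 +i* 1)%C *: (Evec D a - Evec D (- a)).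
Proof.
move=> ra; rewrite /Bvec -(Evec_conj ra); congr Cplx.
by rewrite /= subrr scale0r scaler0 addr0.
Qed.

(** Neither a + b nor a - b is a root or zero, so E_a and E_-a commute with E_b and E_-b. The result
    descends to g because [cplx_of] is an injective morphism. *)
Lemma Uspace_lie_eq0 a b : a \in roots D -> b \in roots D ->
    a + b != 0 -> a + b \notin roots D -> a - b != 0 -> a - b \notin roots D ->
  forall x y, x \in Uspace a -> y \in Uspace b -> [[x, y]] = 0.
Proof.
move=> ra rb s0 s d0 d; have ra' := rootN ra; have rb' := rootN rb.
have E1 : [[Evec D a, Evec D b]] = 0 by rewrite Evec_nonroot.
have E2 : [[Evec D a, Evec D (- b)]] = 0 by rewrite Evec_nonroot.
have oppr_root c : (- c \in roots D) = (c \in roots D).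
  by apply/idP/idP => /rootN; rewrite ?opprK.
have E3 : [[Evec D (- a), Evec D b]] = 0.
  by rewrite Evec_nonroot // -[b]opprK -opprD ?oppr_eq0 ?oppr_root.
have E4 : [[Evec D (- a), Evec D (- b)]] = 0.
  by rewrite Evec_nonroot // -opprD ?oppr_eq0 ?oppr_root.
have lD u v w : [[u + v, w]] = [[u, w]] + [[v, w]] :> cplx g.
  by rewrite -[LHS]/(lier _ _) linearD.
have lN u v : [[- u, v]] = - [[u, v]] :> cplx g.
  by rewrite -[LHS]/(lier _ _) linearN.
have lZ c u v : [[c *: u, v]] = c *: [[u, v]] :> cplx g.
  by rewrite -[LHS]/(lier _ _) linearZ.
apply: lie_span_eq0 => x y; rewrite !inE => xa yb.
suff : cplx_of [[x, y]] = 0 by case.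
rewrite cplx_of_lie; case/orP: xa => /eqP ->; case/orP: yb => /eqP ->.
all: rewrite ?cplx_of_Avec ?cplx_of_Bvec // ?(lD, lN, lZ) ?linearZ /=.
all: by rewrite !(linearD, linearN) /= ?(lD, lN, lZ) E1 E2 E3 E4;
  rewrite !(oppr0, scaler0, addr0).
Qed.

(** By orthogonality of root vectors, this is minus the E_a-component of x. It detects the summand
    U_a without proving that the sum of the U_b is direct. *)
Definition killing_coef a x : R[i] := killing (cplx_of x) (Evec D (- a)).

Lemma killing_coefD a x y :
  killing_coef a (x + y) = killing_coef a x + killing_coef a y.
Proof. by rewrite /killing_coef cplx_ofD killingDl. Qed.

Lemma killing_coef0 a : killing_coef a 0 = 0.
Proof. by apply: (addrI (killing_coef a 0)); rewrite -killing_coefD !addr0. Qed.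

Lemma killing_coef_Avec a : a \in roots D -> killing_coef a (Avec a) = -1.
Proof.
move=> ra; rewrite /killing_coef cplx_of_Avec // killingDl Evec_killing //.
have [a0 _] := (rootsP a).1 ra; rewrite killing_Evec_eq0 ?addr0 ?rootN //.
rewrite -opprD oppr_eq0; apply: contra_neq a0 => aa.
have : (2 : R[i]) *: a = 0 by rewrite scaler_nat mulr2n.
by move/eqP; rewrite scaler_eq0 pnatr_eq0 => /eqP.
Qed.

(** U_b involves both E_b and E_-b; the two inequalities make each of them orthogonal to E_-a. *)
Lemma killing_coef_Uspace a b x : a \in roots D -> b \in roots D ->
  b != a -> b != - a -> x \in Uspace b -> killing_coef a x = 0.
Proof.
move=> ra rb ba bNa xb.
have E1 : killing (Evec D b) (Evec D (- a)) = 0.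
  have bBa : b - a != 0 by apply: contra_neq ba => /subr0_eq.
  exact: killing_Evec_eq0 rb (rootN ra) bBa.
have E2 : killing (Evec D (- b)) (Evec D (- a)) = 0.
  by rewrite killing_Evec_eq0 ?rootN // -opprD oppr_eq0 addr_eq0.
move: xb; rewrite /Uspace span_cons span_seq1.
case/memv_addP => _ /vlineP[p ->] [_ /vlineP[q ->] ->] .
rewrite killing_coefD /killing_coef !cplx_ofZ !killingZl.
rewrite cplx_of_Avec // cplx_of_Bvec // killingZl !killingDl killingNl E1 E2.
by rewrite oppr0 !addr0 !mulr0 addr0.
Qed.

Lemma killing_coef_sum a (s : seq (dual (torus D))) x : a \in roots D ->
    {in s, forall b, [/\ b \in roots D, b != a & b != - a]} ->
  x \in (\sum_(b <- s) Uspace b)%VS -> killing_coef a x = 0.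
Proof.
move=> ra; elim: s x => [|b s IH] x bP.
  by rewrite big_nil memv0 => /eqP ->; exact: killing_coef0.
rewrite big_cons => /memv_addP[y yb [z zs ->] ].
have [rb ba bNa] := bP b (mem_head _ _).
rewrite killing_coefD (killing_coef_Uspace ra rb) // add0r.
by apply: IH => // c cs; apply: bP; rewrite inE cs orbT.
Qed.

End Roots.

(** * Chains of simple roots *)

Lemma sumv_seq_sup (K : fieldType) (V : vectType K) (I : eqType)
    (U : I -> {vspace V}) (s : seq I) a :
  a \in s -> (U a <= \sum_(b <- s) U b)%VS.
Proof.
elim: s => //= b s IH; rewrite inE big_cons => /orP[/eqP <-|/IH sa].
  exact: addvSl.
exact: subv_trans sa (addvSr _ _).
Qed.

Section SimpleRoots.
Variables (R : realType) (g : lieAlgType R) (n : nat) (D : root_setup g n).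
Implicit Types (a b : dual (torus D)) (p q i j k : 'I_n).

Notation "'Pi_ k" := ((simple D)`_k) (at level 8, k at level 2).
Notation coordPi := (coord (simple D)).

Lemma simple_in_roots p : 'Pi_p \in roots D.
Proof. by apply: simple_root; rewrite mem_nth ?size_tuple. Qed.

Lemma coord_simple p k : coordPi k 'Pi_p = (k == p)%:R.
Proof. by rewrite coord_free 1?eq_sym //; exact: simple_free. Qed.

Lemma coord_comb (c : 'I_n -> nat) k :
  coordPi k (\sum_(p < n) 'Pi_p *+ c p) = (c k)%:R.
Proof.
rewrite linear_sum (bigD1 k) //= linearMn /= coord_simple eqxx big1 ?addr0 //.
by move=> p pk; rewrite linearMn /= coord_simple eq_sym (negPf pk) mul0rn.
Qed.

Lemma coord_root_sign a : a \in roots D ->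
  (forall k, 0 <= coordPi k a) \/ (forall k, coordPi k a <= 0).
Proof.
move=> /simple_sign[c [->|->] ]; [left|right] => k.
  by rewrite coord_comb ler0n.
by rewrite linearN /= coord_comb oppr_le0 ler0n.
Qed.

(** Its coordinates 1 at p and -1 at q have opposite signs. *)
Lemma simpleB_nonroot p q : p != q -> 'Pi_p - 'Pi_q \notin roots D.
Proof.
move=> pq; apply/negP => /coord_root_sign[/(_ q)|/(_ p)];
  rewrite linearB /= !coord_simple eqxx.
  by rewrite eq_sym (negPf pq) sub0r oppr_ge0 ler10.
by rewrite (negPf pq) subr0 ler10.
Qed.

Lemma coord_neq a b k : coordPi k a != coordPi k b -> a != b.
Proof. by apply: contra_neq => ->. Qed.

Lemma simple_Hvec p q :
  killing (vsval (Hvec D (tnth (simple D) p)))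
    (vsval (Hvec D (tnth (simple D) q)))
  = 'Pi_q (Hvec D 'Pi_p).
Proof.
by rewrite HvecP ?(tnth_nth 0) // simple_in_roots.
Qed.

Lemma simpleD_pos p q :
  'Pi_p + 'Pi_q \in roots D -> 'Pi_p + 'Pi_q \in pos_roots D.
Proof.
move=> pq; rewrite mem_filter pq andbT; apply/asboolP.
exists (fun k => (k == p) + (k == q))%N.
have simpleE (r : 'I_n) : 'Pi_r = \sum_(k < n) 'Pi_k *+ (k == r).
  rewrite (bigD1 r) //= eqxx big1 ?addr0 // => k kr.
  by rewrite (negPf kr).
rewrite (simpleE p) (simpleE q) -big_split /=.
by apply: eq_bigr => k _; rewrite mulrnDr.
Qed.

(** If a = - b, the natural coordinates of a and b add up to 0, so all of them vanish and the root a
    is 0. *)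
Lemma pos_roots_neqN a b :
  a \in pos_roots D -> b \in pos_roots D -> a != - b.
Proof.
rewrite !mem_filter => /andP[/asboolP[c ac] ra] /andP[/asboolP[d bd] _].
have [a0 _] := (rootsP a).1 ra; apply: contra_neq a0 => ab.
have cd k : (c k + d k = 0)%N.
  apply/eqP; rewrite -(pnatr_eq0 R[i]) natrD -!coord_comb -ac -bd ab.
  by rewrite linearN addNr.
rewrite ac big1 // => k _.
by have /eqP := cd k; rewrite addn_eq0 => /andP[/eqP -> _].
Qed.

(** Used contrapositively: a root with a non-zero coordinate at a black node lies outside R_K. *)
Lemma coord_RK i j a : in_RK i j a -> coordPi i a = 0 /\ coordPi j a = 0.
Proof.
case/asboolP=> c ->.
have E k : (k == i) || (k == j) ->
    coordPi k (\sum_(p < n | (p != i) && (p != j)) 'Pi_p *~ c p) = 0.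
  move=> kij; rewrite linear_sum big1 // => p /andP[pi pj].
  rewrite /= raddfMz /= coord_simple; case: eqP => [kp|_]; last exact: mul0rz.
  by move: kij; rewrite kp (negPf pi) (negPf pj).
by split; apply: E; rewrite eqxx ?orbT.
Qed.

(** * The strongly orthogonal pair attached to a chain a - b - c *)

Section Chain.
Variables (i j a b c : 'I_n).
Hypotheses (ab : a != b) (bc : b != c) (ac : a != c).
Hypothesis ij : (i, j) = (b, c) \/ (i, j) = (c, b).
Hypotheses (Cbb : cartan_number D b b = 2) (Ccc : cartan_number D c c = 2).
Hypotheses (Cab : cartan_number D a b = -1) (Ccb : cartan_number D c b = -1).
Hypothesis (Cac : cartan_number D a c = 0).

Let al : dual (torus D) := 'Pi_a + 'Pi_b.
Let be : dual (torus D) := 'Pi_b + 'Pi_c.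
Let B p q : R[i] := 'Pi_q (Hvec D 'Pi_p).

Fact B_sym p q : B p q = B q p.
Proof. by rewrite /B -!simple_Hvec killingC. Qed.

Fact cartanE p q : cartan_number D p q = 2 * B p q / B q q.
Proof. by rewrite /cartan_number !simple_Hvec. Qed.

Fact Bbb_neq0 : B b b != 0.
Proof.
(* Division by zero yields 0, so a vanishing [B b b] would make the Cartan number 0 instead of 2. *)
apply/eqP => Bb; move/eqP: Cbb.
by rewrite cartanE Bb invr0 mulr0 eq_sym pnatr_eq0.
Qed.

Fact Bcc_neq0 : B c c != 0.
Proof.
apply/eqP => Bb; move/eqP: Ccc.
by rewrite cartanE Bb invr0 mulr0 eq_sym pnatr_eq0.
Qed.

Fact half_B p : cartan_number D p b = -1 -> B p b *+ 2 = - B b b.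
Proof.
rewrite cartanE => /(canRL (divfK Bbb_neq0)).
by rewrite mulN1r mulrC mulr_natr.
Qed.

Fact B_neq0 p : cartan_number D p b = -1 -> B p b != 0.
Proof.
move/half_B => h; apply/eqP => z; move: h.
by rewrite z mul0rn => /esym/eqP; rewrite oppr_eq0 (negPf Bbb_neq0).
Qed.

Fact Bac_eq0 : B a c = 0.
Proof.
have /eqP := Cac; rewrite cartanE !mulf_eq0 invr_eq0 (negPf Bcc_neq0).
by rewrite pnatr_eq0 orbF => /eqP.
Qed.

Fact simpleD_neq0 p q : 'Pi_p + 'Pi_q != 0.
Proof.
apply: (@coord_neq _ _ p); rewrite linearD linear0 /= !coord_simple eqxx.
by rewrite -natrD pnatr_eq0.
Qed.

Fact simpleB_neq0 p q : p != q -> 'Pi_p - 'Pi_q != 0.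
Proof.
move=> pq; apply: (@coord_neq _ _ p).
by rewrite linearB linear0 /= !coord_simple eqxx (negPf pq) subr0 oner_eq0.
Qed.

(** A difference of distinct simple roots is never a root, so [add_root] applies and the non-zero
    product with b makes the sum a root. *)
Fact neighbour_root p :
  p != b -> cartan_number D p b = -1 -> 'Pi_p + 'Pi_b \in roots D.
Proof.
move=> pb /B_neq0; rewrite B_sym /B => Bpb.
by rewrite (add_root (simple_in_roots p) (simple_in_roots b)
  (simpleB_neq0 pb) (simpleB_nonroot pb) (simpleD_neq0 p b)).
Qed.

Fact al_root : al \in roots D.
Proof. exact: neighbour_root. Qed.

Fact be_root : be \in roots D.
Proof.
by rewrite /be [_ + _]addrC; apply: neighbour_root; rewrite // eq_sym.
Qed.

Fact alBbe : al - be = 'Pi_a - 'Pi_c.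
Proof. by rewrite /al /be opprD addrA addrK. Qed.

Fact coord_al k : coordPi k al = ((k == a) + (k == b))%:R.
Proof. by rewrite linearD /= !coord_simple natrD. Qed.

Fact coord_be k : coordPi k be = ((k == b) + (k == c))%:R.
Proof. by rewrite linearD /= !coord_simple natrD. Qed.

Fact alDbe_neq0 : al + be != 0.
Proof.
apply: (@coord_neq _ _ b).
by rewrite linearD linear0 /= coord_al coord_be eqxx -natrD pnatr_eq0 addn1.
Qed.

Fact alBbe_neq0 : al - be != 0.
Proof. by rewrite alBbe simpleB_neq0. Qed.

Fact alBbe_nonroot : al - be \notin roots D.
Proof. by rewrite alBbe simpleB_nonroot. Qed.

(* <al, be> = <a,b> + <b,b> + <a,c> + <b,c> = 0, where twice the first and twice
   the last term are - <b,b>. *)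
Fact alDbe_nonroot : al + be \notin roots D.
Proof.
rewrite (add_root al_root be_root alBbe_neq0 alBbe_nonroot alDbe_neq0) negbK.
have Hsym (r s : dual (torus D)) : r \in roots D -> s \in roots D ->
    (r (Hvec D s) : R[i]) = s (Hvec D r).
  by move=> rr rs; rewrite -(HvecP rr) -(HvecP rs) killingC.
have -> : (al (Hvec D be) : R[i]) = B b a + B b b + (B c a + B c b).
  rewrite (Hsym _ _ al_root be_root) add_lfunE.
  rewrite (Hsym _ _ (simple_in_roots b) al_root).
  by rewrite (Hsym _ _ (simple_in_roots c) al_root) !add_lfunE.
have E : (B b a + B b b + (B c a + B c b)) *+ 2 = 0.
  rewrite (B_sym b a) (B_sym c a) Bac_eq0 add0r !mulrnDl.
  rewrite (half_B Cab) (half_B Ccb).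
  by rewrite mulr2n addKr subrr.
by move/eqP: E; rewrite mulrn_eq0.
Qed.

Fact al_pos : al \in pos_roots D.
Proof. exact: simpleD_pos al_root. Qed.

Fact be_pos : be \in pos_roots D.
Proof. exact: simpleD_pos be_root. Qed.

Fact al_RM : al \in RM_pos D i j.
Proof.
rewrite mem_filter al_pos andbT; apply/negP => /coord_RK.
by rewrite !coord_al; case: ij => -[-> ->] [] /eqP;
  rewrite eqxx addn1 ?pnatr_eq0 // => _ /eqP; rewrite pnatr_eq0.
Qed.

Fact be_RM : be \in RM_pos D i j.
Proof.
rewrite mem_filter be_pos andbT; apply/negP => /coord_RK.
by rewrite !coord_be; case: ij => -[-> ->] [] /eqP;
  rewrite eqxx ?addn1 ?add1n pnatr_eq0.
Qed.

(** The coordinate at c is 0 for [al] and 1 for [be]. As c is black, this puts the two roots in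
    different modules m(p, q). *)
Fact c_coord_neq : coordPi c al != coordPi c be.
Proof.
rewrite coord_al coord_be eqxx ![c == _]eq_sym (negPf ac) (negPf bc).
by rewrite eq_sym oner_eq0.
Qed.

Fact al_neq_be : al != be.
Proof. exact: coord_neq c_coord_neq. Qed.

(** U_r lies in m(p, q), where L is a scalar. Since b is one of the black nodes i, j, its non-zero
    coordinate excludes (p, q) = (0, 0), where nothing is known of L. *)
Fact metric_scalar (L : 'End(g)) r : metric_operator D i j L ->
    r \in RM_pos D i j -> coordPi b r != 0 ->
    (exists p q : nat, coordPi i r = p%:R /\ coordPi j r = q%:R) ->
  exists l : R, {in Uspace r, forall v, L v = l *: v}.
Proof.
case=> lam [_ Lm]; rewrite mem_filter => /andP[_ rpos] rb [p [q [rp rq] ] ].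
exists (lam p q) => v vr; apply: Lm.
  apply: contra_neq rb => -[p0 q0].
  by case: ij => -[Ei Ej]; rewrite -?Ei -?Ej ?rp ?rq ?p0 ?q0.
have rm : r \in Rm D i j p q by rewrite mem_filter rp rq !eqxx.
exact: (subvP (sumv_seq_sup (@Uspace _ _ _ D) rm)).
Qed.

(** With L = s on U_al and L = t on U_be, the bracket [x + y, s x + t y] reduces to (t - s) [x, y],
    and x, y commute. *)
Fact chain_lie_eq0 (L : 'End(g)) v : metric_operator D i j L ->
  v \in (Uspace al + Uspace be)%VS -> [[v, L v]] = 0.
Proof.
move=> mL; case/memv_addP=> x xal [y ybe ->].
have [||s sP] := metric_scalar mL al_RM.
- by rewrite coord_al eqxx addn1 pnatr_eq0.
- by rewrite !coord_al; do 2!eexists.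
have [||t tP] := metric_scalar mL be_RM.
- by rewrite coord_be eqxx pnatr_eq0.
- by rewrite !coord_be; do 2!eexists.
have xy : [[x, y]] = 0.
  exact: (Uspace_lie_eq0 al_root be_root alDbe_neq0 alDbe_nonroot
    alBbe_neq0 alBbe_nonroot).
rewrite linearD /= (sP x xal) (tP y ybe) linearD /= !linearZ /=.
rewrite !lieDl !liexx [lie y x]lie_anti xy.
by rewrite oppr0 !addr0 !scaler0 addr0.
Qed.

Let X : g := Avec al + Avec be.

Fact Avec_Uspace r : Avec r \in @Uspace _ _ _ D r.
Proof. by rewrite memv_span ?mem_head. Qed.

Fact killing_coef_X r : r \in [:: al; be] -> killing_coef r X = -1.
Proof.
have neqN u v : u \in pos_roots D -> v \in pos_roots D -> u != - v.
  exact: pos_roots_neqN.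
rewrite !inE killing_coefD => /orP[] /eqP ->.
  rewrite (killing_coef_Avec al_root).
  rewrite (killing_coef_Uspace al_root be_root _ _ (Avec_Uspace be)) ?addr0 //.
    by rewrite eq_sym al_neq_be.
  exact: neqN be_pos al_pos.
rewrite (killing_coef_Avec be_root).
rewrite (killing_coef_Uspace be_root al_root _ _ (Avec_Uspace al)) ?add0r //.
  exact: al_neq_be.
exact: neqN al_pos be_pos.
Qed.

Lemma chain_structural :
  exists Z : g, structural D i j Z /\ ~ trivial_vector D i j Z.
Proof.
exists X; have mproj0 : mproj D i j 0 = 0 by exact: linear0.
split; first split; first split.
- by apply: memvD; [apply: (subvP (sumv_seq_sup _ al_RM)) |
    apply: (subvP (sumv_seq_sup _ be_RM))]; exact: Avec_Uspace.
- apply/eqP => X0; have /eqP := killing_coef_X (mem_head _ _).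
  by rewrite X0 killing_coef0 eq_sym oppr_eq0 oner_eq0.
- move=> L mL; rewrite chain_lie_eq0 ?mproj0 //.
  by rewrite memv_add ?Avec_Uspace.
(* Indicator coefficients along the A_r and zero ones along the B_r make the support exactly {[al],
   [be]}. *)
- exists (fun r => (r \in [:: al; be])%:R), (fun=> 0); split.
    have RMu : uniq (RM_pos D i j) by rewrite !filter_uniq ?roots_uniq.
    have perm :
        perm_eq [seq r <- RM_pos D i j | r \in [:: al; be] ] [:: al; be].
      apply: uniq_perm; first exact: filter_uniq.
        by rewrite /= inE al_neq_be.
      move=> r; rewrite mem_filter; apply: andb_idr.
      by rewrite !inE => /orP[] /eqP ->; [exact: al_RM | exact: be_RM].
    transitivity (\sum_(r <- RM_pos D i j | r \in [:: al; be]) Avec r).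
      by rewrite -big_filter (perm_big _ perm) !big_cons big_nil /= addr0.
    rewrite big_mkcond; apply: eq_bigr => r _; rewrite scale0r [RHS]addr0.
    by case: ifP => _; rewrite ?scale1r ?scale0r.
  move=> Y YS L mL; rewrite chain_lie_eq0 ?mproj0 //.
  apply: (subvP _) YS; rewrite big_seq.
  apply: (big_ind (fun U => (U <= Uspace al + Uspace be)%VS))
    => [|U V UP VP|r].
  - exact: sub0v.
  - by rewrite subv_add UP VP.
  - rewrite mem_filter eqxx orbF pnatr_eq0 eqb0 negbK !inE.
    by case/andP => /orP[] /eqP -> _; [exact: addvSl | exact: addvSr].
case=> p [q [_ Xm] ].
(* Non-triviality: [al] and [be] differ at the black node c, so one of them, r, is missing from [Rm]
   p q. Pairing with E_-r then gives 0 on m(p, q) but -1 on [X]. *)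
have [r rX rm] : exists2 r, r \in [:: al; be] & r \notin Rm D i j p q.
  case: (boolP (al \in Rm D i j p q)) => alm; last first.
    by exists al; rewrite ?mem_head.
  exists be; first by rewrite !inE eqxx orbT.
  apply/negP; move: alm; rewrite !mem_filter.
  move=> /andP[/andP[/eqP a1 /eqP a2] _] /andP[/andP[/eqP b1 /eqP b2] _].
  move/eqP: c_coord_neq; apply.
  by case: ij a1 a2 b1 b2 => -[-> ->] a1 a2 b1 b2; rewrite ?a1 ?b1 ?a2 ?b2.
have rpos : r \in pos_roots D.
  by move: rX; rewrite !inE => /orP[] /eqP ->; [exact: al_pos | exact: be_pos].
have rr : r \in roots D by move: rpos; rewrite mem_filter => /andP[].
have /eqP := killing_coef_X rX.
rewrite (killing_coef_sum rr _ Xm) 1?eq_sym ?oppr_eq0 ?oner_eq0 //.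
move=> s sm; split.
- by move: sm; rewrite !mem_filter => /andP[_ /andP[] ].
- by apply: contraNneq rm => <-.
- by apply: pos_roots_neqN => //; move: sm; rewrite mem_filter => /andP[].
Qed.

End Chain.
End SimpleRoots.

(** * Chains read off from a Cartan matrix *)

Section Diagrams.
Variables (R : realType) (g : lieAlgType R) (n : nat).
Variables (D : root_setup g n.+1) (C : nat -> nat -> int).
Hypothesis DC : has_cartan_matrix D C.

(** The lower bounds matter because [node] takes a predecessor: labels 0 and 1 would give the same
    index. *)
Lemma cartan_number_node p q : (0 < p <= n.+1)%N -> (0 < q <= n.+1)%N ->
  cartan_number D (node n p) (node n q) = (C p q)%:~R.
Proof.
move=> /andP[p0 pn] /andP[q0 qn].
by rewrite DC /node !inordK ?prednK.
Qed.

Lemma node_neq p q : (0 < p <= n.+1)%N -> (0 < q <= n.+1)%N -> p != q ->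
  node n p != node n q.
Proof.
move=> /andP[p0 pn] /andP[q0 qn]; apply: contra_neq => /(congr1 val).
by rewrite /= !inordK ?prednK // => E; rewrite -(prednK p0) E prednK.
Qed.

Lemma node_chain_structural i j a b c :
    all (fun k => 0 < k <= n.+1)%N [:: a; b; c] -> uniq [:: a; b; c] ->
    (i, j) = (b, c) \/ (i, j) = (c, b) ->
    C b b = 2 -> C c c = 2 -> C a b = -1 -> C c b = -1 -> C a c = 0 ->
  exists X : g, structural D (node n i) (node n j) X
    /\ ~ trivial_vector D (node n i) (node n j) X.
Proof.
move=> /and4P[an bn cn _]; rewrite /= !inE !andbT negb_or.
move=> /andP[/andP[ab ac] bc] ij Cbb Ccc Cab Ccb Cac.
apply: (@chain_structural _ _ _ D _ _ (node n a) (node n b) (node n c));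
  rewrite ?node_neq // ?cartan_number_node ?Cbb ?Ccc ?Cab ?Ccb ?Cac //.
by case: ij => -[-> ->]; [left | right].
Qed.

End Diagrams.

Theorem theorem1p1 (R : realType) :
  [/\ (* F4 / (U(3) x U(1)) *)
      forall (g : lieAlgType R) (D : root_setup g 4),
        compact_simple g -> has_cartan_matrix D cartan_F4 ->
        exists X : g, structural D (node 3 3) (node 3 4) X
          /\ ~ trivial_vector D (node 3 3) (node 3 4) X,
      (* E6 / (U(3) x U(3)) *)
      forall (g : lieAlgType R) (D : root_setup g 6),
        compact_simple g -> has_cartan_matrix D cartan_E6 ->
        exists X : g, structural D (node 5 3) (node 5 6) X
          /\ ~ trivial_vector D (node 5 3) (node 5 6) X,
      (* E7 / (U(6) x U(1)) *)
      forall (g : lieAlgType R) (D : root_setup g 7),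
        compact_simple g -> has_cartan_matrix D cartan_E7 ->
        exists X : g, structural D (node 6 5) (node 6 6) X
          /\ ~ trivial_vector D (node 6 5) (node 6 6) X
    & (* E8 / (E6 x U(1) x U(1)) *)
      forall (g : lieAlgType R) (D : root_setup g 8),
        compact_simple g -> has_cartan_matrix D cartan_E8 ->
        exists X : g, structural D (node 7 1) (node 7 2) X
          /\ ~ trivial_vector D (node 7 1) (node 7 2) X].

Proof.
split=> g D _ DC.
(* The white end a is 2, 2, 4 and 3 in turn. In F4 the middle node 3 is long, so the entry (2, 3) is
   -1 and only (3, 2) is -2. *)
- by apply: (node_chain_structural DC (a := 2) (b := 3) (c := 4)) => //; left.
- by apply: (node_chain_structural DC (a := 2) (b := 3) (c := 6)) => //; left.
- by apply: (node_chain_structural DC (a := 4) (b := 5) (c := 6)) => //; left.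
(* In E8 the white neighbour is attached to node 2, so the chain runs downwards as 3 - 2 - 1 and the
   black pair (1, 2) is (c, b). *)
- by apply: (node_chain_structural DC (a := 3) (b := 2) (c := 1)) => //; right.
Qed.
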